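(* Let $\mathcal{K}^{\langle\infty\rangle}$ be a planar unbounded simple nested fractal whose number $k\ge3$ of essential fixed points is even. Then $\mathcal{K}^{\langle\infty\rangle}$ has the good labelling property if and only if the $0$-complexes contained in $\mathcal{K}^{\langle 1\rangle}$ can be split into two disjoint classes such that each complex from one class intersects only complexes from the other class.
   Context: Setting: $L>1$, $N\ge2$, $\nu_1=0,\dots,\nu_N\in\mathbb{R}^2$, $\Psi_i(x)=x/L+\nu_i$, and $\mathcal{K}^{\langle 0\rangle}=\bigcup_i\Psi_i(\mathcal{K}^{\langle 0\rangle})$ is a planar simple nested fractal (essential fixed points $V_0^{\langle0\rangle}$: fixed points $x$ for which there are another fixed point $y$ and $\Psi_i\ne\Psi_j$ with $\Psi_i(x)=\Psi_j(y)$; open set condition, nesting, symmetry with respect to perpendicular bisectors of pairs of essential fixed points, connectivity); $k=\#V_0^{\langle0\rangle}$, and $V_0^{\langle0\rangle}$ spans a regular $k$-gon. $\mathcal{K}^{\langle M\rangle}=L^M\mathcal{K}^{\langle 0\rangle}$, $\mathcal{K}^{\langle\infty\rangle}=\bigcup_{M\ge0}\mathcal{K}^{\langle M\rangle}$. An $M$-complex is $\Delta_M=\mathcal{K}^{\langle M\rangle}+\nu_{\Delta_M}$ with $\nu_{\Delta_M}=\sum_{j=M+1}^{J}L^j\nu_{i_j}$ ($J\ge M+1$), vertex set $V(\Delta_M)=L^MV_0^{\langle0\rangle}+\nu_{\Delta_M}$; $V_M^{\langle M\rangle}=L^MV_0^{\langle0\rangle}$ and $V_M^{\langle\infty\rangle}$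 is the union of all $V(\Delta_M)$. With $\mathcal{A}$ an alphabet of $k$ symbols and $\mathcal{R}_M$ the $k$ rotations about the barycenter of $\mathcal{K}^{\langle M\rangle}$ preserving $V_M^{\langle M\rangle}$, a good labelling function of order $M$ is $\ell_M:V_M^{\langle\infty\rangle}\to\mathcal{A}$, bijective on $V_M^{\langle M\rangle}$, such that for each $M$-complex $\Delta_M=\mathcal{K}^{\langle M\rangle}+\nu_{\Delta_M}$ there is $R_{\Delta_M}\in\mathcal{R}_M$ with $\ell_M(v)=\ell_M(R_{\Delta_M}(v-\nu_{\Delta_M}))$, $v\in V(\Delta_M)$. The good labelling property means that a good labelling function of some order $M\in\mathbb{Z}$ exists. *)

(* Defs.v *)
From HB Require Import structures.
From mathcomp Require Import all_boot all_order all_algebra.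
From mathcomp Require Import all_classical all_reals all_analysis.
From Stdlib Require Import Relation_Operators.
Set Implicit Arguments. Unset Strict Implicit. Unset Printing Implicit Defensive.
Import Order.TTheory GRing.Theory Num.Theory.
Import numFieldNormedType.Exports.
Local Open Scope ring_scope.
Local Open Scope classical_set_scope.

Section NestedFractal.
Context {R : realType} {N : nat} (L : R) (nu : 'I_N -> 'rV[R]_2).

Definition Psi (i : 'I_N) (x : 'rV[R]_2) : 'rV[R]_2 := L^-1 *: x + nu i.

Definition Psiw (w : seq 'I_N) (x : 'rV[R]_2) : 'rV[R]_2 :=
  foldr (fun i y => Psi i y) x w.

(* the (unique, since L > 1) fixed point of Psi_i *)
Definition fixpt (i : 'I_N) : 'rV[R]_2 := (L / (L - 1)) *: nu i.

Definition essentialb (x : 'rV[R]_2) : bool :=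
  [exists m : 'I_N, exists i : 'I_N, exists j : 'I_N,
     (Psi i != Psi j) && (Psi i x == Psi j (fixpt m))].

Definition V0 : seq 'rV[R]_2 :=
  undup [seq fixpt m | m <- enum 'I_N & essentialb (fixpt m)].

Definition kk : nat := size V0.

Definition Vn (n : nat) : set 'rV[R]_2 :=
  [set z | exists w : seq 'I_N, size w = n /\ exists2 y, y \in V0 & z = Psiw w y].

Definition dot (x y : 'rV[R]_2) : R := \sum_(j < 2) x ord0 j * y ord0 j.

Definition bisector_refl (x y z : 'rV[R]_2) : 'rV[R]_2 :=
  let u := x - y in let m := 2^-1 *: (x + y) in
  z - ((2 * dot (z - m) u) / dot u u) *: u.

Definition is_attractor (K : set 'rV[R]_2) : Prop :=
  compact K /\ K !=set0 /\ K = \bigcup_(i in [set: 'I_N]) (Psi i @` K).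

Definition open_set_condition : Prop :=
  exists U : set 'rV[R]_2, open U /\ U !=set0 /\
    (forall i, Psi i @` U `<=` U) /\
    (forall i j, i != j -> Psi i @` U `&` Psi j @` U = set0).

Definition nesting (K : set 'rV[R]_2) : Prop :=
  forall (w w' : seq 'I_N), size w = size w' -> w != w' ->
    Psiw w @` K `&` Psiw w' @` K = Psiw w @` [set` V0] `&` Psiw w' @` [set` V0].

Definition symmetry : Prop :=
  forall x y, x \in V0 -> y \in V0 -> x != y ->
    forall n z, Vn n z -> Vn n (bisector_refl x y z).

Definition connectivity (K : set 'rV[R]_2) : Prop :=
  forall i j : 'I_N,
    clos_refl_trans 'I_N (fun a b => Psi a @` K `&` Psi b @` K !=set0) i j.

Definition planar_simple_nested_fractal (K : set 'rV[R]_2) : Prop :=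
  1 < L /\ (2 <= N)%N /\ (forall i : 'I_N, val i = 0%N -> nu i = 0) /\
  is_attractor K /\ open_set_condition /\ nesting K /\ symmetry /\
  connectivity K.

Fixpoint shiftv (e : int) (s : seq 'I_N) : 'rV[R]_2 :=
  if s is i :: s' then (L ^ e) *: nu i + shiftv (e + 1) s' else 0.

(* v is the translation vector nu_{Delta_M} = sum_{j=M+1}^J L^j nu_{i_j},
   J >= M+1, of an M-complex Delta_M = K^<M> + v *)
Definition complex_vec (M : int) (v : 'rV[R]_2) : Prop :=
  exists s : seq 'I_N, s != [::] /\ v = shiftv (M + 1) s.

Definition KM (K : set 'rV[R]_2) (M : int) : set 'rV[R]_2 :=
  [set (L ^ M) *: x | x in K].

Definition complex_set (K : set 'rV[R]_2) (M : int) (v : 'rV[R]_2) :=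
  [set x + v | x in KM K M].

Definition VMM (M : int) : set 'rV[R]_2 := [set (L ^ M) *: y | y in [set` V0]].

Definition VMinf (M : int) : set 'rV[R]_2 :=
  [set x | exists v, complex_vec M v /\ exists2 y, y \in V0 & x = (L ^ M) *: y + v].

(* barycenter of K^<M>, i.e. the centre of the regular k-gon V_M^<M> *)
Definition baryM (M : int) : 'rV[R]_2 :=
  (L ^ M) *: ((kk%:R)^-1 *: \sum_(y <- V0) y).

Definition rot (c : 'rV[R]_2) (a b : R) (x : 'rV[R]_2) : 'rV[R]_2 :=
  let d := x - c in
  c + \row_(j < 2) (if val j == 0%N then a * d ord0 ord0 - b * d ord0 (lift ord0 ord0)
                    else b * d ord0 ord0 + a * d ord0 (lift ord0 ord0)).

Definition rotations (M : int) : set ('rV[R]_2 -> 'rV[R]_2) :=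
  [set f | exists a b : R, a ^+ 2 + b ^+ 2 = 1 /\ f = rot (baryM M) a b /\
           f @` VMM M = VMM M].

Definition good_labelling (M : int) (ell : 'rV[R]_2 -> 'I_kk) : Prop :=
  (forall x y, VMM M x -> VMM M y -> ell x = ell y -> x = y) /\
  (forall a : 'I_kk, exists2 x, VMM M x & ell x = a) /\
  (forall v, complex_vec M v ->
     exists2 rho, rotations M rho &
       forall x, x \in V0 -> ell ((L ^ M) *: x + v) = ell (rho ((L ^ M) *: x))).

Definition good_labelling_property : Prop :=
  exists (M : int) (ell : 'rV[R]_2 -> 'I_kk), good_labelling M ell.

Definition zero_complexes_in_K1 (K : set 'rV[R]_2) : set (set 'rV[R]_2) :=
  [set D | exists v, complex_vec 0 v /\ D = complex_set K 0 v /\ D `<=` KM K 1].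

Definition bipartite_zero_complexes (K : set 'rV[R]_2) : Prop :=
  exists cls : set 'rV[R]_2 -> bool,
    forall D D', zero_complexes_in_K1 K D -> zero_complexes_in_K1 K D' ->
      D <> D' -> D `&` D' !=set0 -> cls D != cls D'.

End NestedFractal.

(* Main.v *)
Require Import Defs.
From HB Require Import structures.
From mathcomp Require Import all_boot all_order all_algebra.
From mathcomp Require Import all_classical all_reals all_analysis.
From mathcomp Require Import ring.
From Stdlib Require Import Relation_Operators.

(* By symmetry the essential fixed points lie on a circle, and evenness of their
   number makes them invariant under the antipodal map [eta]. The key fact is that
   two distinct complexes of the same order meet at most in a vertex which they see
   from antipodal corners; in particular a vertex belongs to at most two cells. Hence
   the rotations attached to two neighbouring complexes by a good labelling differ by
   the half-turn [eta], and any function of rotations taking different values at [r] and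
   [eta r] separates neighbours. Conversely the rotations can be sought in {1, eta},
   i.e. one needs a proper 2-colouring of all 0-complexes. The symmetries permute
   the cells, so the parity [e] of the colours of the corner cells of [K^<1>] at [x]
   and at [eta x] does not depend on [x]; according to this parity, the colouring
   of [K^<1>] extends either by repeating it in each 1-complex or by twisting it
   with the (recursively defined) colour of the 1-complex. *)

Set Implicit Arguments. Unset Strict Implicit. Unset Printing Implicit Defensive.
Import Order.TTheory GRing.Theory Num.Theory.
Import numFieldNormedType.Exports.

(** * Plane geometry: bisector reflections, half-turns and rotations *)

Section Plane.
Local Open Scope ring_scope.
Context {R : realType}.
Implicit Types (x y z w a c p : 'rV[R]_2) (t : R).

Definition antipode c z : 'rV[R]_2 := c + (c - z).

Lemma rV2_eq x y : x ord0 ord0 = y ord0 ord0 ->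
  x ord0 (lift ord0 ord0) = y ord0 (lift ord0 ord0) -> x = y.
Proof.
move=> e0 e1; apply/rowP=> j; rewrite ord1 in e0 e1 *.
by case: (unliftP ord0 j) => [k ->|->] //; rewrite ord1.
Qed.

Lemma dotE x y : dot x y =
  x ord0 ord0 * y ord0 ord0 + x ord0 (lift ord0 ord0) * y ord0 (lift ord0 ord0).
Proof. by rewrite /dot big_ord_recl big_ord1. Qed.

Lemma dot_eq0 x : dot x x = 0 -> x = 0.
Proof.
move/eqP; rewrite dotE -!expr2 paddr_eq0 ?sqr_ge0 // !sqrf_eq0.
by case/andP=> /eqP e0 /eqP e1; apply: rV2_eq; rewrite !mxE.
Qed.

Lemma dot_sub_neq0 x y : x != y -> dot (x - y) (x - y) != 0.
Proof. by apply: contra => /eqP/dot_eq0/eqP; rewrite subr_eq0. Qed.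

Lemma antipodeK c z : antipode c (antipode c z) = z.
Proof. by apply: rV2_eq; rewrite !mxE; ring. Qed.

Lemma antipode_fix c z : antipode c z = z -> z = c.
Proof.
move=> e; have -> : z = 2^-1 *: (z + z) by apply: rV2_eq; rewrite !mxE; field.
by rewrite -{2}e; apply: rV2_eq; rewrite !mxE; field.
Qed.

(** This form of affinity serves at once for additivity, homogeneity, half-turns and the
    contractions [Psi i]. *)
Lemma refl_affine x y z w w' t :
  bisector_refl x y (z + t *: (w - w')) =
  bisector_refl x y z + t *: (bisector_refl x y w - bisector_refl x y w').
Proof. by apply: rV2_eq; rewrite /bisector_refl !dotE !mxE; ring. Qed.

Lemma refl_involutive x y : x != y -> involutive (bisector_refl x y).
Proof.
move=> nxy z; have := dot_sub_neq0 nxy.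
rewrite /bisector_refl; set u := x - y; set m := 2^-1 *: _ => u0.
have -> : dot (z - 2 * dot (z - m) u / dot u u *: u - m) u = - dot (z - m) u.
  by move: u0; rewrite !dotE !mxE => u0; field.
by apply: rV2_eq; rewrite !mxE; ring.
Qed.

Lemma refl_perp x y p : x != y -> dot (p - x) (x - y) = 0 ->
  bisector_refl x y p = p - (x - y).
Proof.
move=> nxy; have := dot_sub_neq0 nxy; rewrite /bisector_refl => u0 h.
rewrite (_ : dot (p - _) _ = dot (x - y) (x - y) / 2); last first.
  apply/eqP; rewrite -subr_eq0; apply/eqP; rewrite -h !dotE !mxE.
  by field.
by congr (_ - _); rewrite mulrCA mulfV ?pnatr_eq0 // mulr1 mulfV ?L_neq0 // scale1r.
Qed.

Lemma refl_swap x y : x != y -> bisector_refl x y x = y.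
Proof.
by move=> nxy; rewrite refl_perp // ?subKr// !dotE !mxE; ring.
Qed.

Lemma refl_fix_dist x y c : x != y -> bisector_refl x y c = c ->
  dot (x - c) (x - c) = dot (y - c) (y - c).
Proof.
move=> nxy; have := dot_sub_neq0 nxy; rewrite /bisector_refl => u0 h.
have : dot (x - y) (x - y) * (2 * dot (c - 2^-1 *: (x + y)) (x - y)) = 0.
  rewrite -[RHS](_ : dot (c - (c - (2 * dot (c - 2^-1 *: (x + y)) (x - y)) /
    dot (x - y) (x - y) *: (x - y))) (x - y) * dot (x - y) (x - y) = 0).
    by move: u0; rewrite !dotE !mxE => u0; field.
  by rewrite h subrr dotE !mxE; ring.
move/eqP; rewrite mulf_eq0 (negPf u0) /= => /eqP h2.
apply/eqP; rewrite -subr_eq0; apply/eqP; rewrite -[RHS]oppr0 -h2 !dotE !mxE.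
by field.
Qed.

(* In complex notation centred at c the reflection is [w |-> a z conj(w) / |a|^2]. *)
Lemma refl_complex c a z w : a != z ->
  dot (a - c) (a - c) = dot (z - c) (z - c) ->
  let A := a - c in let Z := z - c in let W := w - c in
  let s := A ord0 ord0 * Z ord0 ord0 -
           A ord0 (lift ord0 ord0) * Z ord0 (lift ord0 ord0) in
  let t := A ord0 ord0 * Z ord0 (lift ord0 ord0) +
           A ord0 (lift ord0 ord0) * Z ord0 ord0 in
  dot A A *: (bisector_refl a z w - c) =
  \row_(j < 2) (if j == ord0 then s * W ord0 ord0 + t * W ord0 (lift ord0 ord0)
                else t * W ord0 ord0 - s * W ord0 (lift ord0 ord0)).
Proof.
move=> naz eAZ A Z W s t; have u0 := dot_sub_neq0 naz.
have eu : a - z = A - Z by rewrite /A /Z opprB addrA subrK.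
have er : bisector_refl a z w - c =
          W - (2 * dot W (A - Z) / dot (A - Z) (A - Z)) *: (A - Z).
  have em : dot (w - 2^-1 *: (a + z)) (a - z) = dot W (A - Z).
    rewrite eu; apply/eqP; rewrite -subr_eq0; apply/eqP.
    transitivity (2^-1 * (dot Z Z - dot A A)); first by rewrite !dotE !mxE; field.
    by rewrite -/A -/Z in eAZ; rewrite eAZ subrr mulr0.
  by rewrite /bisector_refl em eu [LHS]addrAC.
rewrite eu in u0; rewrite er; rewrite -/A -/Z in eAZ.
(* [E1] and [E2] are the real and imaginary parts of [A Z |U|^2 = - |A|^2 U^2] with [U = A - Z].
   They hold modulo [|A|^2 = |Z|^2], so each proof writes 0 as [|A|^2 - |Z|^2] times an explicit
   cofactor. *)
have E1 : dot A A * ((A - Z) ord0 (lift ord0 ord0) ^+ 2 - (A - Z) ord0 ord0 ^+ 2)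
   = s * dot (A - Z) (A - Z).
  apply/eqP; rewrite -subr_eq0; apply/eqP.
  rewrite -[RHS](mul0r (A ord0 (lift ord0 ord0) ^+ 2 - A ord0 ord0 ^+ 2 + s)).
  by rewrite -{1}(subrr (dot A A)) {3}eAZ /s !dotE !mxE; ring.
have E2 : dot A A * (- 2 * (A - Z) ord0 (lift ord0 ord0) * (A - Z) ord0 ord0)
   = t * dot (A - Z) (A - Z).
  apply/eqP; rewrite -subr_eq0; apply/eqP.
  rewrite -[RHS](mul0r (t - 2 * A ord0 (lift ord0 ord0) * A ord0 ord0)).
  by rewrite -{1}(subrr (dot A A)) {3}eAZ /t !dotE !mxE; ring.
set q := dot A A in E1 E2 *; set U := A - Z in E1 E2 u0 *; clearbody s t q U W.
apply: rV2_eq; rewrite !mxE /=; apply: (mulIf u0).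
  transitivity ((s * dot U U) * W ord0 ord0 +
    (t * dot U U) * W ord0 (lift ord0 ord0)); last by ring.
  by rewrite -E1 -E2; move: u0; rewrite !dotE => u0; field.
transitivity ((t * dot U U) * W ord0 ord0 -
  (s * dot U U) * W ord0 (lift ord0 ord0)); last by ring.
by rewrite -E1 -E2; move: u0; rewrite !dotE => u0; field.
Qed.

Definition axis_refl c x z : 'rV[R]_2 :=
  c + (2 * dot (z - c) (x - c) / dot (x - c) (x - c)) *: (x - c) - (z - c).

(** In complex notation: [p v = A Z conj(X)] and [p w = A X conj(v)] give [p w = X^2 conj(Z)], the
    reflection of [Z] in the line through [X], scaled by [p]. *)
Lemma conj_mul_conj (p A0 A1 X0 X1 Z0 Z1 v0 v1 w0 w1 : R) :
  A0 * A0 + A1 * A1 = p -> X0 * X0 + X1 * X1 = p -> p != 0 ->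
  p * v0 = (A0 * Z0 - A1 * Z1) * X0 + (A0 * Z1 + A1 * Z0) * X1 ->
  p * v1 = (A0 * Z1 + A1 * Z0) * X0 - (A0 * Z0 - A1 * Z1) * X1 ->
  p * w0 = (A0 * X0 - A1 * X1) * v0 + (A0 * X1 + A1 * X0) * v1 ->
  p * w1 = (A0 * X1 + A1 * X0) * v0 - (A0 * X0 - A1 * X1) * v1 ->
  w0 = 2 * (Z0 * X0 + Z1 * X1) / p * X0 - Z0 /\
  w1 = 2 * (Z0 * X0 + Z1 * X1) / p * X1 - Z1.
Proof.
move=> eA eX p0 ev0 ev1 ew0 ew1.
split; apply: (mulfI p0); apply: (mulfI p0).
  transitivity ((A0 * X0 - A1 * X1) * (p * v0) + (A0 * X1 + A1 * X0) * (p * v1)).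
    by rewrite ew0; ring.
  rewrite ev0 ev1.
  transitivity ((A0 * A0 + A1 * A1) * (2 * (Z0 * X0 + Z1 * X1) * X0 -
    (X0 * X0 + X1 * X1) * Z0)); first by ring.
  by rewrite eA eX; field.
transitivity ((A0 * X1 + A1 * X0) * (p * v0) - (A0 * X0 - A1 * X1) * (p * v1)).
  by rewrite ew1; ring.
rewrite ev0 ev1.
transitivity ((A0 * A0 + A1 * A1) * (2 * (Z0 * X0 + Z1 * X1) * X1 -
  (X0 * X0 + X1 * X1) * Z1)); first by ring.
by rewrite eA eX; field.
Qed.

Lemma refl_refl c a x z : a != x -> a != z -> x != c ->
  dot (a - c) (a - c) = dot (x - c) (x - c) ->
  dot (z - c) (z - c) = dot (x - c) (x - c) ->
  bisector_refl a x (bisector_refl a z x) = axis_refl c x z.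
Proof.
move=> nax naz nxc eax ezx; have q0 := dot_sub_neq0 nxc.
have := refl_complex x naz (etrans eax (esym ezx)).
have := refl_complex (bisector_refl a z x) nax eax.
rewrite /=; set v := bisector_refl a z x; set w := bisector_refl a x v.
move=> /rowP ew /rowP ev.
have := ew ord0; have := ew (lift ord0 ord0).
have := ev ord0; have := ev (lift ord0 ord0).
clearbody w v; move: q0 eax ezx; rewrite /axis_refl !mxE /= !dotE !mxE /=.
move=> q0 eax ezx e1 e2 e3 e4.
rewrite eax in e1 e2 e3 e4.
have [h0 h1] := conj_mul_conj eax erefl q0 e2 e1 e4 e3.
apply: rV2_eq; rewrite !mxE -addrA.
  by rewrite -[LHS](subrK (c ord0 ord0)) addrC h0.
by rewrite -[LHS](subrK (c ord0 (lift ord0 ord0))) addrC h1.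
Qed.

(** The power of the inner point with respect to the circle is [- t (1 - t) |x - y|^2], which is
    nonzero. *)
Lemma chord_inner c x y t : x != y -> 0 < t < 1 ->
  dot (x - c) (x - c) = dot (y - c) (y - c) ->
  dot (x + t *: (y - x) - c) (x + t *: (y - x) - c) != dot (x - c) (x - c).
Proof.
move=> nxy /andP[t0 t1] exy; have u0 := dot_sub_neq0 nxy.
rewrite -subr_eq0 (_ : _ - _ = - (t * (1 - t) * dot (x - y) (x - y))).
  by rewrite oppr_eq0 !mulf_eq0 !negb_or u0 (gt_eqF t0) subr_eq0 (gt_eqF t1).
apply/eqP; rewrite -subr_eq0; apply/eqP.
transitivity (t * (dot (y - c) (y - c) - dot (x - c) (x - c))).
  by rewrite !dotE !mxE; ring.
by rewrite exy subrr mulr0.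
Qed.

Lemma dot_thales c x y : dot (x - c) (x - c) = dot (y - c) (y - c) ->
  dot (antipode c y - x) (x - y) = 0.
Proof.
move=> exy; transitivity (dot (y - c) (y - c) - dot (x - c) (x - c)).
  by rewrite !dotE !mxE; ring.
by rewrite exy subrr.
Qed.

Lemma axis_reflK c x : x != c -> involutive (axis_refl c x).
Proof.
move=> nxc z; have q0 := dot_sub_neq0 nxc; rewrite /axis_refl.
by apply: rV2_eq; move: q0; rewrite !dotE !mxE => q0; field.
Qed.

Definition cross c x z : R :=
  (x - c) ord0 ord0 * (z - c) ord0 (lift ord0 ord0) -
  (x - c) ord0 (lift ord0 ord0) * (z - c) ord0 ord0.

Lemma cross_axis_refl c x z : x != c -> cross c x (axis_refl c x z) = - cross c x z.
Proof.
move=> nxc; have q0 := dot_sub_neq0 nxc; rewrite /axis_refl /cross.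
by move: q0; rewrite !dotE !mxE => q0; field.
Qed.

(** On the circle, the product of the squared distances from [z] to [x] and to its antipode is
    [4 (cross c x z)^2]. *)
Lemma cross_eq0 c x z : x != c -> dot (z - c) (z - c) = dot (x - c) (x - c) ->
  cross c x z = 0 -> z = x \/ z = antipode c x.
Proof.
move=> nxc ezx h; have q0 := dot_sub_neq0 nxc.
have e : dot (z - x) (z - x) * dot (z - antipode c x) (z - antipode c x) = 0.
  transitivity ((dot (z - c) (z - c) - dot (x - c) (x - c)) ^+ 2 +
     4 * cross c x z ^+ 2).
    by rewrite /cross !dotE !mxE; ring.
  by rewrite h ezx subrr expr0n /= mulr0 addr0.
move/eqP: e; rewrite mulf_eq0 => /orP[] /eqP/dot_eq0/eqP; rewrite subr_eq0 => /eqP;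
  by [left|right].
Qed.
Lemma rotE c t u z : let d := z - c in
  (Defs.rot c t u z - c) ord0 ord0 = t * d ord0 ord0 - u * d ord0 (lift ord0 ord0) /\
  (Defs.rot c t u z - c) ord0 (lift ord0 ord0) =
    u * d ord0 ord0 + t * d ord0 (lift ord0 ord0).
Proof. by rewrite /Defs.rot /= addrC addKr !mxE. Qed.

Lemma rot_scale c t u (k : R) z :
  Defs.rot (k *: c) t u (k *: z) = k *: Defs.rot c t u z.
Proof. by apply: rV2_eq; rewrite /Defs.rot !mxE /=; ring. Qed.

Lemma rot1 c z : Defs.rot c 1 0 z = z.
Proof. by apply: rV2_eq; rewrite /Defs.rot !mxE /=; ring. Qed.

Lemma rotN1 c z : Defs.rot c (-1) 0 z = antipode c z.
Proof. by apply: rV2_eq; rewrite /Defs.rot !mxE /=; ring. Qed.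

Lemma rot_antipode c t u z :
  Defs.rot c t u (antipode c z) = antipode c (Defs.rot c t u z).
Proof. by apply: rV2_eq; rewrite /Defs.rot !mxE /=; ring. Qed.

Lemma antipode_rot c t u z :
  antipode c (Defs.rot c t u z) = Defs.rot c (- t) (- u) z.
Proof. by apply: rV2_eq; rewrite /Defs.rot !mxE /=; ring. Qed.

(** Multiplying the image by the conjugate of [z - c] recovers [(t, u)] up to the factor
    [|z - c|^2]. *)
Lemma rot_inj_angle c t u t' u' z : z != c ->
  Defs.rot c t u z = Defs.rot c t' u' z -> t = t' /\ u = u'.
Proof.
move=> nzc e; have q0 := dot_sub_neq0 nzc.
have [e0 e1] := rotE c t u z; have [] := rotE c t' u' z; rewrite -e e0 e1.
move: q0; rewrite dotE; set d0 := (z - c) _ _; set d1 := (z - c) _ _ => q0 h0 h1.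
split; apply: (mulIf q0).
  transitivity ((t * d0 - u * d1) * d0 + (u * d0 + t * d1) * d1); first by ring.
  by rewrite h0 h1; ring.
transitivity ((u * d0 + t * d1) * d0 - (t * d0 - u * d1) * d1); first by ring.
by rewrite h0 h1; ring.
Qed.

End Plane.

Section NestedFractal.
Local Open Scope ring_scope.
Local Open Scope classical_set_scope.
Context {R : realType} {N : nat} {L : R} {nu : 'I_N -> 'rV[R]_2}
  {K : set 'rV[R]_2}.
Hypothesis fractalK : planar_simple_nested_fractal L nu K.
Hypothesis kk_ge3 : (3 <= kk L nu)%N.
Hypothesis kk_even : ~~ odd (kk L nu).

Notation V := (V0 L nu).
Notation c := ((kk L nu)%:R^-1 *: \sum_(y <- V0 L nu) y).
Notation eta := (antipode c).
Notation psi := (Psi L nu).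
Notation psiw := (Psiw L nu).
Implicit Types (x y z a : 'rV[R]_2) (i j m : 'I_N) (s w : seq 'I_N).

(** * The essential fixed points: common circle and antipodal symmetry *)

Lemma L_gt1 : 1 < L. Proof. by case: fractalK. Qed.

Lemma L_gt0 : 0 < L. Proof. exact: lt_trans ltr01 L_gt1. Qed.

Lemma L_neq0 : L != 0. Proof. by rewrite gt_eqF ?L_gt0. Qed.

Lemma invL_gt0 : 0 < L^-1. Proof. by rewrite invr_gt0 L_gt0. Qed.

Lemma invL_lt1 : L^-1 < 1. Proof. by rewrite invf_lt1 ?L_gt1 ?L_gt0. Qed.

Lemma Psi_fixpt i : psi i (fixpt L nu i) = fixpt L nu i.
Proof.
have l1 : L - 1 != 0 by rewrite subr_eq0 gt_eqF // L_gt1.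
move: L_neq0 l1 => l0 l1.
by apply: rV2_eq; rewrite /Psi /fixpt !mxE; field; rewrite l0 l1.
Qed.

Lemma V0_fixpt x : x \in V -> exists i, fixpt L nu i = x.
Proof. by rewrite mem_undup => /mapP[i _ ->]; exists i. Qed.

Lemma V0_uniq : uniq V. Proof. exact: undup_uniq. Qed.

Lemma V0_refl x y z : x \in V -> y \in V -> x != y -> z \in V ->
  bisector_refl x y z \in V.
Proof.
case: fractalK => _ [_ [_ [_ [_ [_ [sym _]]]]]] Vx Vy nxy Vz.
have [|w [/size0nil -> [v Vv ->]]] // := sym x y Vx Vy nxy 0%N z.
by exists [::]; split=> //; exists z.
Qed.

Lemma V0_perm_refl x y : x \in V -> y \in V -> x != y ->
  perm_eq (map (bisector_refl x y) V) V.
Proof.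
move=> Vx Vy nxy; apply: uniq_perm; rewrite ?V0_uniq //.
  by rewrite map_inj_uniq ?V0_uniq //; apply/inv_inj/refl_involutive.
move=> z; apply/mapP/idP => [[v Vv ->]|Vz]; first exact: V0_refl.
by exists (bisector_refl x y z); rewrite ?V0_refl ?refl_involutive.
Qed.

Lemma kk_neq0 : (kk L nu)%:R != 0 :> R.
Proof. by rewrite pnatr_eq0 -lt0n (leq_trans _ kk_ge3). Qed.

(** An affine map permuting [V] fixes its mean; [g] is the linear part. *)
Lemma refl_bary x y : x \in V -> y \in V -> x != y -> bisector_refl x y c = c.
Proof.
move=> Vx Vy nxy; set f := bisector_refl x y.
pose g z := f z - f 0.
have gD z a : g (z + a) = g z + g a.
  have := refl_affine x y z a 0 1; rewrite !scale1r subr0 -/f /g => ->.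
  by rewrite addrAC.
have gZ t z : g (t *: z) = t *: g z.
  have := refl_affine x y 0 z 0 t; rewrite add0r subr0 -/f /g => ->.
  by rewrite addrAC subrr add0r.
have gsum (s : seq 'rV[R]_2) : g (\sum_(z <- s) z) = \sum_(z <- s) g z.
  elim: s => [|z s ih]; last by rewrite !big_cons gD ih.
  by rewrite !big_nil /g subrr.
have : g c = c - f 0.
  rewrite gZ gsum; apply: (scalerI kk_neq0); rewrite scalerBr !scalerA.
  rewrite mulfV ?kk_neq0 // !scale1r.
  rewrite sumrB -(big_map f xpredT id) /= (perm_big _ (V0_perm_refl Vx Vy nxy)) /=.
  by rewrite big_const_seq count_predT iter_addr_0 scaler_nat.
by move/addIr.
Qed.

Lemma V0_circle x y : x \in V -> y \in V ->
  dot (x - c) (x - c) = dot (y - c) (y - c).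
Proof.
move=> Vx Vy; have [->//|nxy] := eqVneq x y.
exact: refl_fix_dist nxy (refl_bary Vx Vy nxy).
Qed.

Lemma V0_third x y : exists a, [/\ a \in V, a != x & a != y].
Proof.
have /hasP[a Va] : has [predC [:: x; y]] V.
  rewrite has_predC; apply/negP => /allP sub.
  by have := leq_trans kk_ge3 (uniq_leq_size V0_uniq sub).
by rewrite /= !inE negb_or => /andP[ax ay]; exists a.
Qed.

Lemma V0_neq_bary x : x \in V -> x != c.
Proof.
move=> Vx; apply/eqP => ex; have [a [Va ax _]] := V0_third x x.
have := V0_circle Va Vx; rewrite -ex subrr [RHS]dotE !mxE mulr0 addr0.
by move=> /dot_eq0/eqP; rewrite subr_eq0 (negPf ax).
Qed.

Lemma V0_axis_refl x z : x \in V -> z \in V -> axis_refl c x z \in V.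
Proof.
move=> Vx Vz; have [a [Va ax az]] := V0_third x z.
rewrite -(@refl_refl _ c a) ?V0_neq_bary //; try exact: V0_circle.
by rewrite !V0_refl.
Qed.

(* The axial symmetry fixing [x] exchanges the two sides of the axis, so that
   parity leaves room for a second point on the axis. *)
Lemma V0_antipode x : x \in V -> eta x \in V.
Proof.
move=> Vx; apply: contraR kk_even => nVx; have nxc := V0_neq_bary Vx.
pose f := axis_refl c x; pose side z := cross c x z.
have fK : involutive f by exact: axis_reflK.
have fV : perm_eq (map f V) V.
  apply: uniq_perm; rewrite ?V0_uniq //.
    by rewrite map_inj_uniq ?V0_uniq //; exact: inv_inj.
  move=> z; apply/mapP/idP => [[v Vv ->]|Vz]; first exact: V0_axis_refl.
  by exists (f z); [exact: V0_axis_refl | rewrite fK].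
have eside : count (fun z => 0 < side z) V = count (fun z => side z < 0) V.
  rewrite -(seq.permP fV) count_map; apply: eq_count => z /=.
  by rewrite /side /f cross_axis_refl // oppr_gt0.
(* Without the antipode only [x] lies on the axis, so the number of vertices is one plus twice the
   number on one side. *)
have e0 : count (fun z => side z == 0) V = 1%N.
  transitivity (count_mem x V); last by rewrite count_uniq_mem ?V0_uniq ?Vx.
  apply: eq_in_count => z Vz /=; apply/eqP/eqP => [|->]; last first.
    by rewrite /side /cross; ring.
  case/(cross_eq0 nxc (V0_circle Vz Vx)) => // ez.
  by rewrite -ez Vz in nVx.
rewrite /kk -(count_predC (fun z => side z == 0)) e0.
have -> : count (predC (fun z => side z == 0)) V =
  (count (fun z => 0 < side z)%R V + count (fun z => side z < 0)%R V)%N.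
  rewrite -count_predUI [X in (_ + X)%N](_ : _ = 0)%N ?addn0.
    by apply: eq_count => z /=; rewrite neq_lt orbC.
  by apply/eqP; rewrite -leqn0 leqNgt -has_count; apply/hasPn => z _ /=;
     case: ltgtP.
by rewrite eside addnn oddD odd_double.
Qed.

Lemma V0_neq_antipode x : x \in V -> x != eta x.
Proof.
by move=> Vx; apply: contra (V0_neq_bary Vx) => /eqP h; apply/eqP/antipode_fix.
Qed.

(** * Cells of the attractor and how they meet *)

Lemma PsiwE w z y : psiw w z = psiw w y + L^-1 ^+ size w *: (z - y).
Proof.
elim: w => [|i w ih] /=; first by rewrite expr0 scale1r addrC subrK.
by rewrite /Psi ih scalerDr scalerA -exprS addrAC.
Qed.

Lemma Psiw_inj w : injective (psiw w).
Proof.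
move=> z y; rewrite (PsiwE w z y) => /eqP; rewrite -subr_eq0 addrC addKr.
rewrite scaler_eq0 expf_eq0 invr_eq0 (negPf L_neq0) andbF subr_eq0.
by move/eqP.
Qed.

Lemma geometric_closed (F : set 'rV[R]_2) a z : closed F -> ~ F a ->
  \forall n \near \oo, ~ F (a + L^-1 ^+ n *: z).
Proof.
move=> clF nFa.
have cv : (fun n => a + L^-1 ^+ n *: z) @ \oo --> a.
  rewrite -[X in _ --> X](_ : a + 0 *: z = a); last by rewrite scale0r addr0.
  apply: cvgD; first exact: cvg_cst.
  apply: cvgZr_tmp; apply: cvg_expr.
  by rewrite ger0_norm ?invL_lt1 // ltW ?invL_gt0.
have /cv : nbhs a (~` F) by apply: open_nbhs_nbhs; split=> //; apply: closed_openC.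
exact.
Qed.

Lemma attractor_Psi z : K z <-> exists i, exists2 y, K y & psi i y = z.
Proof.
case: fractalK => _ [_ [_ [[_ [_ eK]] _]]].
by rewrite {1}eK; split=> [[i _ [y Ky <-]]|[i [y Ky <-]]]; exists i => //; exists y.
Qed.

Lemma attractor_Psiw w z : K z -> K (psiw w z).
Proof.
by move=> Kz; elim: w => //= i w ih; apply/attractor_Psi; exists i, (psiw w z).
Qed.

Lemma attractor_closed : closed K.
Proof.
case: fractalK => _ [_ [_ [[cK _] _]]].
by apply: compact_closed => //; apply: norm_hausdorff.
Qed.

(** The iterates of [Psi i] on any point of [K] stay in the closed set [K] and converge to the fixed
    point. *)
Lemma attractor_fixpt i : K (fixpt L nu i).
Proof.
case: fractalK => _ [_ [_ [[_ [[y Ky] _]] _]]].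
apply: contrapT => nK.
have /filter_ex[n []] := geometric_closed (y - fixpt L nu i) attractor_closed nK.
suff -> : fixpt L nu i + L^-1 ^+ n *: (y - fixpt L nu i) = psiw (nseq n i) y.
  exact: attractor_Psiw.
rewrite (PsiwE _ y (fixpt L nu i)) size_nseq; congr (_ + _).
by elim: n => //= n <-; rewrite Psi_fixpt.
Qed.

Lemma attractor_V0 x : x \in V -> K x.
Proof. by move=> /V0_fixpt[i <-]; apply: attractor_fixpt. Qed.

Lemma nesting_V0 w w' z z' : size w = size w' -> w != w' -> K z -> K z' ->
  psiw w z = psiw w' z' -> z \in V /\ z' \in V.
Proof.
case: fractalK => _ [_ [_ [_ [_ [nest _]]]]] sw nw Kz Kz' e.
have : (psiw w @` K `&` psiw w' @` K) (psiw w z).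
  by split; [exists z | exists z'].
rewrite nest // => -[[v Vv ev] [v' Vv' ev']].
by rewrite e in ev'; rewrite -(Psiw_inj ev) -(Psiw_inj ev').
Qed.

(** The witness is the image of [y] in the corner cell at [x]: it lies strictly inside a chord,
    hence off the circle. Nesting forbids two distinct cells of one level to share such a point. *)
Lemma inner_point x y : x \in V -> y \in V -> x != y ->
  exists p, [/\ Vn L nu 1 p, K p, p \notin V & p = x + L^-1 *: (y - x)].
Proof.
move=> Vx Vy nxy; have [i ei] := V0_fixpt Vx.
have ep : psiw [:: i] y = x + L^-1 *: (y - x).
  by rewrite (PsiwE _ y x) /= expr1 -ei Psi_fixpt.
exists (psiw [:: i] y); split=> //.
- by exists [:: i]; split=> //; exists y.
- exact/attractor_Psiw/attractor_V0.
rewrite ep; apply/negP => Vp.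
have t01 : 0 < L^-1 < 1 by rewrite invL_gt0 invL_lt1.
by have := chord_inner nxy t01 (V0_circle Vx Vy); rewrite (V0_circle Vp Vx) eqxx.
Qed.

Lemma Vn_attractor n z : Vn L nu n z -> K z.
Proof. by case=> w [_ [y Vy ->]]; apply/attractor_Psiw/attractor_V0. Qed.

(* If [x'] were not antipodal to [x], the reflection exchanging them would map
   the line through [x] and the antipode of [x'] to its translate by [x' - x]
   (Thales); the two cells, being translates of each other by a multiple of
   [x - x'], would then share an interior point of that chord. *)
Lemma cells_antipodal w w' z z' : size w = size w' -> w != w' -> K z -> K z' ->
  psiw w z = psiw w' z' -> [/\ z \in V, z' \in V & z' = eta z].
Proof.
move=> sw nw Kz Kz' e; have [Vz Vz'] := nesting_V0 sw nw Kz Kz' e; split=> //.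
(* Cells of equal level are translates, so points with equal offsets from [z] and [z'] have the same
   image. *)
have share p q : K p -> K q -> p \notin V -> p - z = q - z' -> False.
  move=> Kp Kq nVp epq.
  suff /(nesting_V0 sw nw Kp Kq)[] : psiw w p = psiw w' q by rewrite (negPf nVp).
  by rewrite (PsiwE w p z) (PsiwE w' q z') epq e sw.
have [ezz'|nzz'] := eqVneq z z'.
  have [p [_ Kp nVp _]] := inner_point Vz (V0_antipode Vz) (V0_neq_antipode Vz).
  by case: (share p p) => //; rewrite ezz'.
have [ez|nze] := eqVneq z (eta z'); first by rewrite ez antipodeK.
have [p [Vp Kp nVp ep]] := inner_point Vz (V0_antipode Vz') nze.
case: fractalK => _ [_ [_ [_ [_ [_ [sym _]]]]]].
have /Vn_attractor := sym _ _ Vz Vz' nzz' _ _ Vp.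
rewrite refl_perp //; last first.
  rewrite ep addrC addKr dotE !mxE.
  transitivity (L^-1 * dot (eta z' - z) (z - z')).
    by rewrite dotE !mxE; ring.
  by rewrite (dot_thales (V0_circle Vz Vz')) mulr0.
move=> Kq; case: (share p _ Kp Kq nVp).
by apply: rV2_eq; rewrite !mxE; ring.
Qed.

Lemma Psi_antipodal i j z z' : i != j -> K z -> K z' -> psi i z = psi j z' ->
  [/\ z \in V, z' \in V & z' = eta z].
Proof.
move=> nij Kz Kz' e; apply: (@cells_antipodal [:: i] [:: j]) => //.
by rewrite eqseq_cons andbT.
Qed.

(* Otherwise [x] would be a vertex of the three cells [ii], [ij] and [ji'], with [i']
   the cell of the antipode, and these cannot be pairwise antipodal. *)
Lemma corner_cell i j x z : x \in V -> fixpt L nu i = x -> K z -> psi j z = x ->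
  i = j /\ z = x.
Proof.
move=> Vx ei Kz e; have fx : psi i x = x by rewrite -ei Psi_fixpt.
have [eij|nij] := eqVneq i j; first rewrite -eij in e *.
  by split=> //; apply: (@Psiw_inj [:: i]); rewrite /= fx.
have Kx := attractor_V0 Vx.
have [_ Vz ez] := Psi_antipodal nij Kx Kz (etrans fx (esym e)).
have [i' ei'] := V0_fixpt Vz.
have fz : psi i' z = z by rewrite -ei' Psi_fixpt.
have nw : [:: i; j] != [:: j; i'] by rewrite eqseq_cons (negPf nij).
(* Both second-level cells see [x] from the same corner [z], although distinct cells must see it
   from antipodal ones. *)
have e2 : psiw [:: i; j] z = psiw [:: j; i'] z by rewrite /= e fx fz e.
have [_ _ ezz] := @cells_antipodal [:: i; j] [:: j; i'] z z erefl nw Kz Kz e2.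
by have := V0_neq_antipode Vz; rewrite -ezz eqxx.
Qed.

Lemma PsiE i z y : psi i z = psi i y + L^-1 *: (z - y).
Proof. by rewrite -[L^-1]expr1 -(PsiwE [:: i]). Qed.

Lemma Psi_index_inj i j z : z \in V -> psi i z = psi j z -> i = j.
Proof.
move=> Vz e; apply/eqP/negPn/negP => nij; have Kz := attractor_V0 Vz.
have [_ _ ez] := Psi_antipodal nij Kz Kz e.
by have := V0_neq_antipode Vz; rewrite -ez eqxx.
Qed.

(** * Bisector reflections permute the cells *)

Lemma refl_antipode x y z : x \in V -> y \in V -> x != y ->
  bisector_refl x y (eta z) = eta (bisector_refl x y z).
Proof.
move=> Vx Vy nxy; have := refl_affine x y c c z 1.
by rewrite !scale1r (refl_bary Vx Vy nxy) => h; apply: h.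
Qed.

(** Both sides are affine with the same linear part, so agreement at one point suffices. *)
Lemma refl_cell x y i j z z' :
  bisector_refl x y (psi i z) = psi j (bisector_refl x y z) ->
  bisector_refl x y (psi i z') = psi j (bisector_refl x y z').
Proof.
by move=> e; rewrite (PsiE i z' z) refl_affine e [RHS](PsiE _ _ (bisector_refl x y z)).
Qed.

Lemma refl_Vn x y n z : x \in V -> y \in V -> x != y -> Vn L nu n z ->
  Vn L nu n (bisector_refl x y z).
Proof.
case: fractalK => _ [_ [_ [_ [_ [_ [sym _]]]]]] Vx Vy nxy.
exact: (sym _ _ Vx Vy nxy).
Qed.

(* The shared vertex [psi m b] is approached by vertices [psi m (b_ n)] of the cell
   [m]; their images approach the image of the shared vertex from outside the cell
   [j], hence from another cell, which must be the antipodal one. *)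
Lemma refl_neighbour x y i j m a b : x \in V -> y \in V -> x != y ->
  (forall z, bisector_refl x y (psi i z) = psi j (bisector_refl x y z)) ->
  i != m -> K a -> K b -> psi i a = psi m b ->
  exists j', forall z, bisector_refl x y (psi m z) = psi j' (bisector_refl x y z).
Proof.
move=> Vx Vy nxy ij nim Ka Kb e; set f := bisector_refl x y in ij *.
have [Va Vb eb] := Psi_antipodal nim Ka Kb e.
have fV z : z \in V -> f z \in V by exact: (V0_refl Vx Vy nxy).
have fK : involutive f by exact: refl_involutive.
have [mb emb] := V0_fixpt Vb.
(* The exponent [n.+1] keeps the ratio strictly below 1, so that [b_ n] is inside the chord and
   never a vertex. *)
pose b_ n := b + L^-1 ^+ n.+1 *: (a - b).
have eb_ n : b_ n = psiw (nseq n.+1 mb) a.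
  rewrite (PsiwE _ a b) size_nseq; congr (_ + _).
  by elim: n.+1 => //= k <-; rewrite -emb Psi_fixpt.
pose back j' z := L *: (z - nu j').
have backK j' z : back j' (psi j' z) = z.
  by rewrite /back /Psi addrK scalerA mulfV ?L_neq0 // scale1r.
have Kback j' z : psi j' (back j' z) = z.
  by rewrite /back /Psi scalerA mulVf ?L_neq0 // scale1r subrK.
have nbV n : b_ n \notin V.
  apply/negP => Vn; have nba : b != a by rewrite eb eq_sym V0_neq_antipode.
  have t01 : 0 < L^-1 ^+ n.+1 < 1.
    by rewrite exprn_gt0 ?exprn_ilt1 ?invL_lt1 ?invL_gt0 // ltW ?invL_gt0.
  by have := chord_inner nba t01 (V0_circle Vb Va); rewrite (V0_circle Vn Vb) eqxx.
have fq n j' : back j' (f (psi m (b_ n))) =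
    back j' (f (psi m b)) + L^-1 ^+ n *: (L^-1 *: (f a - f b)).
  rewrite (PsiE m (b_ n) b).
  have -> : L^-1 *: (b_ n - b) = (L^-1 ^+ n.+1 * L^-1) *: (a - b).
    by rewrite /b_ addrAC subrr add0r scalerA mulrC.
  rewrite /f refl_affine /back addrAC scalerDr; congr (_ + _).
  by rewrite !scalerA exprSr mulrA mulrCA mulfV ?mulr1 ?L_neq0.
(* The cells are finitely many and closed, so one [n] serves them all: each cell containing the
   image of [psi m (b_ n)] contains that of [psi m b]. *)
have : \forall n \near \oo, forall j', ~ K (back j' (f (psi m b))) ->
    ~ K (back j' (f (psi m (b_ n)))).
  apply: filter_forall => j'.
  have [h|h] := pselect (K (back j' (f (psi m b)))); first by apply: nearW => n /(_ h).
  have := geometric_closed (L^-1 *: (f a - f b)) attractor_closed h.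
  by apply: filterS => n; rewrite -fq.
move=> /filter_ex[n hn].
have Vq : Vn L nu n.+2 (psi m (b_ n)).
  exists (m :: nseq n.+1 mb); rewrite /= size_nseq; split=> //.
  by exists a => //; rewrite eb_.
have [[|j' w] [//= [sw]] [v Vv ew]] := refl_Vn Vx Vy nxy Vq.
have Vu : Vn L nu n.+1 (psiw w v) by exists w; split=> //; exists v.
have Ku := Vn_attractor Vu.
have Kt : K (back j' (f (psi m b))).
  apply: contrapT => /hn; apply.
  by rewrite /f ew /= backK.
(* If [j = j'], reflecting back puts [psi m (b_ n)] in the cell [i] too, a shared point that is not
   a vertex. *)
have nj : j != j'.
  apply/eqP => ej; have := ij (f (psiw w v)); rewrite fK ej -ew.
  move/(congr1 f); rewrite !fK => eq.
  have Kb_ : K (b_ n) by rewrite eb_; apply: attractor_Psiw.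
  have Kfu := Vn_attractor (refl_Vn Vx Vy nxy Vu).
  have [_ Vb_ _] := Psi_antipodal nim Kfu Kb_ eq.
  by rewrite (negPf (nbV n)) in Vb_.
have et : psi j (f a) = psi j' (back j' (f (psi m b))) by rewrite Kback -ij e.
have [_ _ ea] := Psi_antipodal nj (attractor_V0 (fV _ Va)) Kt et.
exists j' => z; apply: (@refl_cell _ _ _ _ b).
by rewrite -/f -(Kback j' (f (psi m b))) ea eb /f refl_antipode.
Qed.

Lemma connected_cells i j :
  clos_refl_trans 'I_N (fun k m => psi k @` K `&` psi m @` K !=set0) i j.
Proof. by case: fractalK => _ [_ [_ [_ [_ [_ [_ conn]]]]]]; apply: conn. Qed.

(** The corner cell at [x] goes to the corner cell at [y]; the property then spreads to all cells by
    connectivity. *)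
Lemma refl_cells x y : x \in V -> y \in V -> x != y ->
  forall i, exists j, forall z,
    bisector_refl x y (psi i z) = psi j (bisector_refl x y z).
Proof.
move=> Vx Vy nxy m; have [i ei] := V0_fixpt Vx; have [j ej] := V0_fixpt Vy.
have : exists j, forall z,
    bisector_refl x y (psi i z) = psi j (bisector_refl x y z).
  exists j => z; apply: (@refl_cell _ _ _ _ x).
  by rewrite -{2}ei Psi_fixpt ei refl_swap // -{2}ej Psi_fixpt ej.
move: {ei}(connected_cells i m) => conn.
elim: conn => [{}i {}m [_ [[a Ka <-] [b Kb e]]] [j' hj]|k [j' hj]|i1 i2 i3 _ ih1 _ ih2 h];
  [|by exists j'|exact: ih2 (ih1 h)].
have [<-|nim] := eqVneq i m; first by exists j'.
exact: refl_neighbour Vx Vy nxy hj nim Ka Kb (esym e).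
Qed.

(** * Two-colourings of the cells and the parity of opposite corners *)

Definition proper_colouring (cls : 'I_N -> bool) := forall i j z z',
  i != j -> K z -> K z' -> psi i z = psi j z' -> cls i != cls j.

(** The reflection exchanging [x] and [y] preserves adjacency, so the colouring and its pull-back
    both alternate between neighbours. Their sum is constant by connectivity ([twist]), and is
    compared at the corners [x] and [eta x]. *)
Lemma corner_parity cls x y i i' j j' : proper_colouring cls ->
  x \in V -> y \in V -> fixpt L nu i = x -> fixpt L nu i' = eta x ->
  fixpt L nu j = y -> fixpt L nu j' = eta y ->
  cls i (+) cls i' = cls j (+) cls j'.
Proof.
move=> colour Vx Vy ei ei' ej ej'.
have fix_inj i1 i2 z : z \in V -> fixpt L nu i1 = z -> fixpt L nu i2 = z -> i1 = i2.
  move=> Vz e1 e2; apply: (Psi_index_inj Vz).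
  by have := Psi_fixpt i2; have := Psi_fixpt i1; rewrite e1 e2 => -> ->.
have [exy|nxy] := eqVneq x y.
  by rewrite -exy in ej ej'; rewrite (fix_inj _ _ _ Vx ei ej)
       (fix_inj _ _ _ (V0_antipode Vx) ei' ej').
set f := bisector_refl x y.
pose rel i j := forall z, f (psi i z) = psi j (f z).
have fV z : z \in V -> f z \in V by exact: (V0_refl Vx Vy nxy).
have fK : involutive f by exact: refl_involutive.
have twist i1 i2 : forall j1 j2, rel i1 j1 -> rel i2 j2 ->
    cls i1 (+) cls j1 = cls i2 (+) cls j2.
  elim: (connected_cells i1 i2) => [{}i1 {}i2 i12|{}i1|{}i1 i0 {}i2 _ ih1 _ ih2] j1 j2.
  - move: i12 => [_ [[a Ka <-] [b Kb e]]] r1 r2.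
    have [ei12|ni] := eqVneq i1 i2.
      rewrite -ei12 in r2 *; congr (_ (+) cls _); apply: (Psi_index_inj Vx).
      by rewrite -[x]fK -r1 -r2.
    have [Va Vb eb] := Psi_antipodal ni Ka Kb (esym e).
    have nj : j1 != j2.
      apply/eqP => ej12; have := r1 a; rewrite -e r2 ej12.
      move=> /(Psiw_inj (w:=[:: j2]))/(inv_inj fK) eba.
      by have := V0_neq_antipode Va; rewrite -eb eba eqxx.
    have := colour _ _ _ _ ni Ka Kb (esym e).
    have ef : psi j1 (f a) = psi j2 (f b) by rewrite -r1 -r2 e.
    have := colour _ _ _ _ nj (attractor_V0 (fV _ Va)) (attractor_V0 (fV _ Vb)) ef.
    by do 4![case: (cls _)].
  - move=> r1 r2; congr (_ (+) cls _); apply: (Psi_index_inj Vx).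
    by rewrite -[x]fK -r1 -r2.
  have [j0 r0] := refl_cells Vx Vy nxy i0.
  by move=> r1 r2; rewrite (ih1 _ _ r1 r0) (ih2 _ _ r0 r2).
have corner z k k' : fixpt L nu k = z -> fixpt L nu k' = f z -> rel k k'.
  move=> ek ek' z'; apply: (@refl_cell _ _ _ _ z).
  by have := Psi_fixpt k'; have := Psi_fixpt k; rewrite ek ek' -/f => -> ->.
have r : rel i j by apply: (corner x); rewrite // /f refl_swap.
have r' : rel i' j'.
  by apply: (corner (eta x)); rewrite // /f refl_antipode // refl_swap.
by have := twist _ _ _ _ r r'; do 4![case: (cls _)].
Qed.

(** * Addresses of complexes and the colouring of all 0-complexes *)

Lemma shiftvD (e f : int) s : shiftv L nu (e + f) s = L ^ e *: shiftv L nu f s.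
Proof.
elim: s f => [|i s ih] f /=; first by rewrite scaler0.
by rewrite -addrA ih scalerDr scalerA expfzDr ?L_neq0.
Qed.

Lemma shiftvS (e : int) s : shiftv L nu (e + 1) s = L *: shiftv L nu e s.
Proof. by rewrite addrC shiftvD expr1z. Qed.

(** Addresses start with the lowest power of [L], words with the outermost map, hence [rev]. Thus
    facts on cells of [K] pass to complexes. *)
Lemma shiftv_Psiw s x : x + shiftv L nu 1 s = L ^+ size s *: psiw (rev s) x.
Proof.
elim: s x => [|i s ih] x; first by rewrite /= addr0 scale1r.
rewrite rev_cons -cats1 /Psiw foldr_cat -/(Psiw L nu) /= exprS -scalerA -ih.
rewrite shiftvS scalerDr addrA; congr (_ + _).
by rewrite /Psi scalerDr scalerA mulfV ?L_neq0 // scale1r.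
Qed.

Lemma complexes_antipodal s s' z z' : size s = size s' -> s != s' -> K z -> K z' ->
  z + shiftv L nu 1 s = z' + shiftv L nu 1 s' -> [/\ z \in V, z' \in V & z' = eta z].
Proof.
move=> sz ns Kz Kz' ezz'.
apply: (cells_antipodal (w := rev s) (w' := rev s')) => //.
- by rewrite !size_rev sz.
- by rewrite (inj_eq (can_inj revK)).
apply: (scalerI (expf_neq0 (size s) L_neq0)).
by rewrite -shiftv_Psiw ezz' shiftv_Psiw sz.
Qed.

(* The tail [s'] is the address of the 1-complex. Neighbouring 0-complexes of different
   1-complexes are antipodal corner cells, whose colours in [K^<1>] differ by [e]: if
   [e] holds this suffices, otherwise the colour of the 1-complex has to be added. *)
Fixpoint word_colour (e : bool) (cls : 'I_N -> bool) s : bool :=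
  if s is i :: s' then cls i (+) (~~ e && word_colour e cls s') else false.

Lemma adjacent_complexes cls e s s' z z' : proper_colouring cls ->
  (forall x i i', x \in V -> fixpt L nu i = x -> fixpt L nu i' = eta x ->
     cls i (+) cls i' = e) ->
  size s = size s' -> s != s' -> K z -> K z' ->
  z + shiftv L nu 1 s = z' + shiftv L nu 1 s' ->
  [/\ z \in V, z' \in V, z' = eta z & word_colour e cls s != word_colour e cls s'].
Proof.
move=> colour parity; elim: s s' z z' => [|i s ih] [|j s'] // z z' [sz] ns Kz Kz' ezz'.
have split k u v : v + shiftv L nu 1 (k :: u) = L *: (psi k v + shiftv L nu 1 u).
  rewrite /= shiftvS scalerDr addrA; congr (_ + _).
  by rewrite /Psi scalerDr scalerA mulfV ?L_neq0 // scale1r.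
move: (ezz'); rewrite !split => /(scalerI L_neq0) e1.
have [Vz Vz' az] :=
  complexes_antipodal (s := i :: s) (s' := j :: s') (congr1 succn sz) ns Kz Kz' ezz'.
split=> //.
have [es|ns'] := eqVneq s s'.
  rewrite -es in e1 *; move/addIr: e1 => e1.
  have nij : i != j by apply: contra ns => /eqP ->; rewrite es.
  have := colour _ _ _ _ nij Kz Kz' e1; rewrite /=.
  by case: (cls i) (cls j) (_ && _) => [] [] [].
have Kp k v : K v -> K (psi k v) by move=> Kv; apply: (attractor_Psiw [:: k]).
have [Vp Vp' ap nc] := ih s' _ _ sz ns' (Kp i _ Kz) (Kp j _ Kz') e1.
(* The shared point is a vertex of both 1-complexes, so [corner_cell] identifies [i] and [j] as the
   corner cells at antipodal corners and [parity] applies. *)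
have [k ek] := V0_fixpt Vp; have [k' ek'] := V0_fixpt Vp'.
have [eki _] := corner_cell Vp ek Kz erefl.
have [ekj _] := corner_cell Vp' ek' Kz' erefl.
rewrite ap in ek'; have := parity _ _ _ Vp ek ek'; rewrite eki ekj /=.
move: nc; case: (e).
  by case: (cls i) (cls j) => [] [].
by case: (cls i) (cls j) (word_colour _ _ _) (word_colour _ _ _) => [] [] [] [].
Qed.

Lemma zero_index : exists i0, nu i0 = 0.
Proof.
case: fractalK => _ [N2 [nu0 _]].
by exists (Ordinal (leq_trans (isT : (0 < 2)%N) N2)); apply: nu0.
Qed.

(** Addresses of different lengths are compared after padding by an index with zero translation; the
    colour of that index must be [false]. *)
Lemma word_colour_pad e cls s n i0 : cls i0 = false ->
  word_colour e cls (s ++ nseq n i0) = word_colour e cls s.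
Proof.
move=> c0; elim: s => [|i s /= ->] //=.
by elim: n => //= n ->; rewrite c0 andbF.
Qed.

Lemma shiftv_pad (e : int) s n i0 : nu i0 = 0 ->
  shiftv L nu e (s ++ nseq n i0) = shiftv L nu e s.
Proof.
move=> n0; elim: s e => [|i s ih] e /=; last by rewrite ih.
by elim: n e => //= n ih e; rewrite ih n0 scaler0 addr0.
Qed.

Lemma complexes_meet s s' z z' : K z -> K z' ->
  z + shiftv L nu 1 s = z' + shiftv L nu 1 s' ->
  shiftv L nu 1 s = shiftv L nu 1 s' \/ [/\ z \in V, z' \in V & z' = eta z].
Proof.
move=> Kz Kz' e; have [i0 n0] := zero_index.
have [es|ns] := eqVneq (s ++ nseq (size s') i0) (s' ++ nseq (size s) i0).
  by left; rewrite -(shiftv_pad 1 s (size s') n0) es shiftv_pad.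
right; apply: complexes_antipodal ns Kz Kz' _.
  by rewrite !size_cat !size_nseq addnC.
by rewrite !shiftv_pad.
Qed.

Lemma complex_set0 v : complex_set L K 0 v = [set x + v | x in K].
Proof.
rewrite /complex_set /KM; apply/seteqP; split=> [_ [_ [x Kx <-] <-]|_ [x Kx <-]].
  by exists x; rewrite ?expr0z ?scale1r.
by exists x => //; exists x; rewrite ?expr0z ?scale1r.
Qed.

Lemma V0_nonempty : exists x, x \in V.
Proof. by exists (nth 0 V 0); rewrite mem_nth // -/(kk L nu) (leq_trans _ kk_ge3). Qed.

(** * From a good labelling to two classes *)

Lemma good_labelling_bipartite :
  good_labelling_property L nu -> bipartite_zero_complexes L nu K.
Proof.
case=> M [ell [inj_ell [_ good]]].
have [x0 Vx0] := V0_nonempty.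
have LM0 : L ^ M != 0 by rewrite expfz_neq0 ?L_neq0.
have ell_inj x y : x \in V -> y \in V ->
    ell (L ^ M *: x) = ell (L ^ M *: y) -> x = y.
  by move=> Vx Vy e; apply: (scalerI LM0); apply: inj_ell e; [exists x|exists y].
(* [low] selects one vertex of each antipodal pair; [phi] carries this choice over to labels. *)
pose low y := (index y V < index (eta y) V)%N.
pose phi b := has (fun y => (ell (L ^ M *: y) == b) && low y) V.
have phiE y : y \in V -> phi (ell (L ^ M *: y)) = low y.
  move=> Vy; apply/hasP/idP => [[y' Vy' /andP[/eqP/ell_inj->]] //|ly].
  by exists y; rewrite ?eqxx.
have phi_antipode y : y \in V -> phi (ell (L ^ M *: eta y)) != phi (ell (L ^ M *: y)).
  move=> Vy; have Vey := V0_antipode Vy; rewrite !phiE // /low antipodeK.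
  case: ltngtP => // ei; have := V0_neq_antipode Vy.
  by rewrite -(nth_index 0 Vey) ei nth_index ?eqxx.
(* The class must depend on the set alone, so some translation vector is chosen; the default 0 does
   not arise for complexes. *)
pose vec (D : set 'rV[R]_2) :=
  xget 0 [set v | complex_vec L nu 0 v /\ D = complex_set L K 0 v].
(* Scaling by [L ^ M] turns 0-complexes into [M]-complexes and conjugates the rotations about the
   barycenters. *)
have turn v : complex_vec L nu 0 v -> exists t u : R,
    (forall z, z \in V -> Defs.rot c t u z \in V) /\
    (forall z, z \in V -> ell (L ^ M *: (z + v)) = ell (L ^ M *: Defs.rot c t u z)).
  move=> [s [s0 ev]].
  have cv : complex_vec L nu M (L ^ M *: v).
    by exists s; split; rewrite // ev add0r (shiftvD).
  have [rho [t [u [_ [-> im]]]] ellv] := good _ cv; exists t, u; split=> z Vz.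
    have : [set Defs.rot (baryM L nu M) t u x | x in VMM L nu M]
             (Defs.rot (baryM L nu M) t u (L ^ M *: z)).
      by exists (L ^ M *: z) => //; exists z.
    by rewrite im rot_scale => -[y Vy /(scalerI LM0) <-].
  by rewrite scalerDr ellv // rot_scale.
exists (fun D => phi (ell (L ^ M *: (x0 + vec D)))) => D D'.
move=> [v [cv [eD _]]] [v' [cv' [eD' _]]] nDD' [p [Dp D'p]].
have [{}cv {}eD] : [set v | complex_vec L nu 0 v /\ D = complex_set L K 0 v] (vec D).
  exact: (xgetI _ (conj cv eD)).
have [{}cv' {}eD'] : [set v | complex_vec L nu 0 v /\ D' = complex_set L K 0 v] (vec D').
  exact: (xgetI _ (conj cv' eD')).
have [t [u [rV rell]]] := turn _ cv; have [t' [u' [rV' rell']]] := turn _ cv'.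
rewrite rell // rell' //.
move: Dp D'p; rewrite {1}eD {1}eD' !complex_set0 => -[x Kx ex] [x' Kx' ex'].
have [s [_ es]] := cv; have [s' [_ es']] := cv'; rewrite !add0r in es es'.
have exx' : x + vec D = x' + vec D' by rewrite ex ex'.
have := complexes_meet (s := s) (s' := s') Kx Kx'.
rewrite -es -es' => /(_ exx')[ev|[Vx Vx' ax]].
  by case: nDD'; rewrite eD eD' ev.
have : Defs.rot c t u x = Defs.rot c t' u' x'.
  apply: ell_inj; [exact: rV|exact: rV'|].
  by rewrite -rell // -rell' // exx'.
(* The shared vertex has one label, so the two rotations differ by the half-turn. *)
rewrite ax rot_antipode antipode_rot => /(rot_inj_angle (V0_neq_bary Vx))[-> ->].
by rewrite -antipode_rot phi_antipode ?rV'.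
Qed.

(** * From two classes to a good labelling *)

Lemma bipartite_proper_colouring : bipartite_zero_complexes L nu K ->
  exists2 cls, proper_colouring cls & forall i, nu i = 0 -> cls i = false.
Proof.
move=> [cls0 Hcls]; have [i0 n0] := zero_index.
(* [D i] is the cell [i] of [K] magnified by [L]. *)
pose D i := complex_set L K 0 (L *: nu i).
have LPsi i z : L *: psi i z = z + L *: nu i.
  by rewrite /Psi scalerDr scalerA mulfV ?L_neq0 // scale1r.
have ZD i : zero_complexes_in_K1 L nu K (D i).
  exists (L *: nu i); split; last split=> //.
    by exists [:: i]; rewrite /= addr0 add0r expr1z.
  Show. rewrite /D complex_set0 => _ [x Kx <-]; exists (psi i x).
    exact: (attractor_Psiw [:: i]).
  by rewrite expr1z LPsi.
(* Adding the colour of [D i0] normalises indices of zero translation to [false], as padding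
   requires. *)
exists (fun i => cls0 (D i) (+) cls0 (D i0)) => [i j z z' nij Kz Kz' e|i ni].
  suff : cls0 (D i) != cls0 (D j) by do 3![case: (cls0 _)].
  apply: Hcls => //.
    move=> eD; have [x Vx] := V0_nonempty.
    have [p [_ Kp nVp _]] := inner_point Vx (V0_antipode Vx) (V0_neq_antipode Vx).
    have : D i (p + L *: nu i) by rewrite /D complex_set0; exists p.
    rewrite eD /D complex_set0 => -[q Kq]; rewrite -!LPsi => /(scalerI L_neq0)/esym epq.
    by have [Vp _ _] := Psi_antipodal nij Kp Kq epq; rewrite Vp in nVp.
  exists (z + L *: nu i); rewrite /D !complex_set0; split; first by exists z.
  by exists z'; rewrite // -!LPsi e.
by rewrite /D ni n0 addbb.
Qed.

Lemma bipartite_good_labelling :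
  bipartite_zero_complexes L nu K -> good_labelling_property L nu.
Proof.
move=> /bipartite_proper_colouring[cls colour cls0].
have [x0 Vx0] := V0_nonempty.
have [i1 ei1] := V0_fixpt Vx0; have [i2 ei2] := V0_fixpt (V0_antipode Vx0).
have [i0 n0] := zero_index.
pose e := cls i1 (+) cls i2.
have parity x i i' : x \in V -> fixpt L nu i = x -> fixpt L nu i' = eta x ->
    cls i (+) cls i' = e.
  by move=> Vx ei ei'; apply: (corner_parity colour Vx Vx0).
pose flip (b : bool) z := if b then eta z else z.
have flipV b z : z \in V -> flip b z \in V.
  by case: b => // Vz; apply: V0_antipode.
pose col := word_colour e cls.
(* For neighbours the corners are antipodal and the colours differ, so the two effects cancel. *)
have col_uniq s s' z z' : z \in V -> z' \in V ->
    z + shiftv L nu 1 s = z' + shiftv L nu 1 s' ->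
    flip (col s) z = flip (col s') z'.
  move=> Vz Vz' ez; rewrite /col.
  rewrite -(word_colour_pad e s (size s') (cls0 _ n0)).
  rewrite -(word_colour_pad e s' (size s) (cls0 _ n0)).
  move: ez; rewrite -(shiftv_pad 1 s (size s') n0) -(shiftv_pad 1 s' (size s) n0).
  have [->|ns ez] := eqVneq (s ++ nseq (size s') i0) (s' ++ nseq (size s) i0).
    by move/addIr->.
  have sz : size (s ++ nseq (size s') i0) = size (s' ++ nseq (size s) i0).
    by rewrite !size_cat !size_nseq addnC.
  have [_ _ ->] := adjacent_complexes colour parity sz ns
    (attractor_V0 Vz) (attractor_V0 Vz') ez.
  by do 2![case: word_colour] => //=; rewrite antipodeK.
(* [vert] folds a vertex of the unbounded fractal back onto [V] through any address; [col_uniq]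
   makes this independent of the choice. *)
pose vert p := xget 0 [set y | exists s z, [/\ z \in V, p = z + shiftv L nu 1 s &
  y = flip (col s) z]].
have vertE s z : z \in V -> vert (z + shiftv L nu 1 s) = flip (col s) z.
  move=> Vz; have [s' [z' [Vz' ez ->]]] : [set y | exists s' z', [/\ z' \in V,
      z + shiftv L nu 1 s = z' + shiftv L nu 1 s' & y = flip (col s') z']]
      (vert (z + shiftv L nu 1 s)).
    by apply: (@xgetI _ _ _ (flip (col s) z)); exists s, z.
  by apply: col_uniq.
have vert_id z : z \in V -> vert z = z.
  by move=> Vz; have := vertE [::] z Vz; rewrite /= addr0.
have kk0 : (0 < kk L nu)%N by apply: leq_trans kk_ge3.
pose ell p : 'I_(kk L nu) := insubd (Ordinal kk0) (index (vert p) V).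
have ellE z : z \in V -> val (ell z) = index z V.
  by move=> Vz; rewrite /ell vert_id // val_insubd index_mem Vz.
exists 0, ell; split; [|split].
- move=> _ _ [x Vx <-] [y Vy <-]; rewrite expr0z !scale1r => /(congr1 val).
  by rewrite !ellE // => exy; rewrite -(nth_index 0 Vx) exy nth_index.
- move=> a; have Va : nth 0 V a \in V by apply: mem_nth.
  exists (nth 0 V a); first by exists (nth 0 V a); rewrite // expr0z scale1r.
  by apply: val_inj; rewrite ellE //= index_uniq // V0_uniq.
move=> v [s [_ ->]]; rewrite add0r.
have bary0 : baryM L nu 0 = c by rewrite /baryM expr0z scale1r.
have img (f : 'rV[R]_2 -> 'rV[R]_2) : (forall z, z \in V -> f z \in V) ->
    involutive f -> f @` VMM L nu 0 = VMM L nu 0.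
  move=> fV fK; rewrite /VMM expr0z; apply/seteqP.
  split=> [_ [_ [y Vy <-] <-]|_ [y Vy <-]].
    by exists (f y); rewrite ?scale1r //; apply: fV.
  exists (f y); last by rewrite fK scale1r.
  by exists (f y); rewrite ?scale1r //; apply: fV.
(* The rotation of the complex is the half-turn or the identity, according to its colour. *)
exists (flip (col s)).
  exists (if col s then -1 else 1), 0; rewrite bary0 /flip; split; [|split].
  - by case: (col s); rewrite ?sqrrN expr1n expr0n addr0.
  - by apply/funext => z; case: (col s); rewrite ?rotN1 ?rot1.
  case: (col s); last exact: img.
  by apply: img => z; [apply: V0_antipode|rewrite antipodeK].
move=> x Vx; rewrite expr0z scale1r; congr insubd; congr index.
by rewrite vertE // vert_id // flipV.
Qed.

End NestedFractal.


Theorem theorem3p14 (R : realType) (N : nat) (L : R) (nu : 'I_N -> 'rV[R]_2)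
  (K : set 'rV[R]_2) :
  planar_simple_nested_fractal L nu K ->
  (3 <= kk L nu)%N -> ~~ odd (kk L nu) ->
  (good_labelling_property L nu <-> bipartite_zero_complexes L nu K).
Proof.
move=> fractalK kk_ge3 kk_even; split.
- exact: good_labelling_bipartite fractalK kk_ge3 kk_even.
- exact: bipartite_good_labelling fractalK kk_ge3 kk_even.
Qed.
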